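(* Let $n\ge1$, $\alpha\in(0,2]$ and $\beta>0$, and let $X_{\alpha,\beta}(t)$, $t\in\mathbb{R}^n$, be the Gaussian field with generalized Cauchy covariance, i.e. the centered stationary Gaussian field with covariance $C_{\alpha,\beta}(\tau)=(1+\Vert\tau\Vert^{\alpha})^{-\beta}$. Then $X_{\alpha,\beta}$ is long range dependent if and only if $0<\alpha\beta\le n$.
   Context: $\Vert\cdot\Vert$ is the Euclidean norm on $\mathbb{R}^n$ and $\mathbb{R}_+$ is the set of positive reals. A stationary centered Gaussian field on $\mathbb{R}^n$ with covariance $C(\tau)$ is called long range dependent if $\int_{\mathbb{R}_+^n}|C(\tau)|\,d^n\tau=\infty$; otherwise it is short range dependent. *)

(* Defs.v *)
From HB Require Import structures.
From mathcomp Require Import all_boot all_order all_algebra.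
From mathcomp Require Import all_classical all_reals all_analysis.

Set Implicit Arguments.
Unset Strict Implicit.
Unset Printing Implicit Defensive.

Import Order.TTheory GRing.Theory Num.Theory.
Import numFieldNormedType.Exports.

Local Open Scope classical_set_scope.
Local Open Scope ring_scope.

(* Lebesgue measure on R^n, with R^n as the measurable space of n-tuples (the
   library has the product sigma-algebra on tuples, but no measure on it). *)
Section lebesgue_tuple.
Context {R : realType}.
Local Open Scope ereal_scope.

Definition tuple_of_pair n (x : measurableTypeR R * n.-tuple (measurableTypeR R)) :
  n.+1.-tuple (measurableTypeR R) := [tuple of x.1 :: x.2].

Lemma measurable_tuple_of_pair n : measurable_fun setT (@tuple_of_pair n).
Proof. exact: measurable_cons. Qed.

Section lebesgue_cons.
Variables (n : nat).
Variable m : {sigma_finite_measure set (n.-tuple (measurableTypeR R)) -> \bar R}.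

Definition lebesgue_cons : set (n.+1.-tuple (measurableTypeR R)) -> \bar R :=
  pushforward (lebesgue_measure \x m) (@tuple_of_pair n).

Let lebesgue_cons0 : lebesgue_cons set0 = 0.
Proof. by rewrite /lebesgue_cons /pushforward preimage_set0 measure0. Qed.

Let lebesgue_cons_ge0 A : 0 <= lebesgue_cons A.
Proof. exact: (measure_ge0 (lebesgue_measure \x m)). Qed.

Let lebesgue_cons_sigma_additive : semi_sigma_additive lebesgue_cons.
Proof.
have mf := @measurable_tuple_of_pair n.
move=> F mF tF mUF; rewrite /lebesgue_cons /pushforward preimage_bigcup.
apply: measure_semi_sigma_additive.
- by move=> k; rewrite -[X in measurable X]setTI; exact: mf.
- apply/trivIsetP => /= i j _ _ ij; rewrite -preimage_setI.
  by move/trivIsetP : tF => /(_ _ _ _ _ ij) ->//; rewrite preimage_set0.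
- by rewrite -preimage_bigcup -[X in measurable X]setTI; exact: mf.
Qed.

HB.instance Definition _ := isMeasure.Build _ _ _ lebesgue_cons
  lebesgue_cons0 lebesgue_cons_ge0 lebesgue_cons_sigma_additive.

Let lebesgue_cons_sigma_finite : sigma_finite setT lebesgue_cons.
Proof.
pose mu : {sigma_finite_measure set (measurableTypeR R) -> \bar R} :=
  lebesgue_measure.
have /sigma_finiteP[F [TF ndF Foo]] := sigma_finiteT mu.
have /sigma_finiteP[G [TG ndG Goo]] := sigma_finiteT m.
pose g (t : n.+1.-tuple (measurableTypeR R)) := (thead t, [tuple of behead t]).
have gK : cancel (@tuple_of_pair n) g.
  move=> [a t]; rewrite /g /tuple_of_pair /thead tnth0; congr pair.
  exact/val_inj.
have mg : measurable_fun setT g.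
  apply/measurable_fun_pair; first exact: (measurable_tnth ord0).
  exact: measurable_behead.
exists (fun i => g @^-1` (F i `*` G i)).
  apply/seteqP; split => // t _.
  have [k _ Fk] : (\bigcup_i F i) (g t).1 by rewrite -TF.
  have [l _ Gl] : (\bigcup_i G i) (g t).2 by rewrite -TG.
  exists (maxn k l) => //; split.
    by move: (g t).1 Fk; exact/subsetPset/ndF/leq_maxl.
  by move: (g t).2 Gl; exact/subsetPset/ndG/leq_maxr.
move=> i; have [mF Fi] := Foo i; have [mG Gi] := Goo i; split.
  by rewrite -[X in measurable X]setTI; apply: mg => //; exact: measurableX.
rewrite /lebesgue_cons /pushforward.
rewrite (_ : _ @^-1` _ = F i `*` G i); last first.
  by rewrite -comp_preimage (_ : g \o _ = id)//; apply/funext => x; exact: gK.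
rewrite product_measure1E// lte_mul_pinfty//.
by rewrite ge0_fin_numE.
Qed.

HB.instance Definition _ := Measure_isSigmaFinite.Build _ _ _ lebesgue_cons
  lebesgue_cons_sigma_finite.

End lebesgue_cons.

Fixpoint lebesgue_tuple (n : nat) :
    {sigma_finite_measure set (n.-tuple (measurableTypeR R)) -> \bar R} :=
  match n with
  | 0%N => \d_([tuple] : 0.-tuple (measurableTypeR R))
  | n'.+1 => lebesgue_cons (lebesgue_tuple n')
  end.

Lemma lebesgue_tuple_box n (A : 'I_n -> set (measurableTypeR R)) :
  (forall i, measurable (A i)) ->
  lebesgue_tuple n [set x | forall i, A i (tnth x i)] =
  \prod_(i < n) lebesgue_measure (A i).
Proof.
elim: n A => [|n IH] A mA.
  by rewrite big_ord0 /= diracE mem_set//=; case.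
rewrite big_ord_recl -IH//= /lebesgue_cons /pushforward.
rewrite -product_measure1E//; last first.
  rewrite (_ : [set x | _] = \big[setI/setT]_(i < n)
      ((@tnth _ (measurableTypeR R) ^~ i) @^-1` A (lift ord0 i))).
    apply: bigsetI_measurable => i _.
    by rewrite -[X in measurable X]setTI; apply: measurable_tnth.
  apply/seteqP; split => x /=.
    by move=> h; rewrite -bigcap_seq => i _; exact: h.
  by rewrite -bigcap_seq => h i; apply: h; rewrite /= mem_index_enum.
congr product_measure1; apply/seteqP; split => -[a t] /=.
  move=> h; split; first by have := h ord0; rewrite tnth0.
  by move=> i; have := h (lift ord0 i); rewrite tnthS.
move=> [h0 h] i; have [j ->|->] := unliftP ord0 i; last by rewrite tnth0.
by rewrite tnthS; exact: h.
Qed.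

End lebesgue_tuple.

Section gaussian_field.
Context {R : realType}.

Definition enorm n (x : 'rV[R]_n) : R := Num.sqrt (\sum_(i < n) x 0 i ^+ 2).

Definition row_of_tuple n (x : n.-tuple R) : 'rV[R]_n := \row_(i < n) tnth x i.

Definition positive_orthant n : set (n.-tuple R) :=
  [set x | forall i, 0 < tnth x i].

(* N(m, s^2), a Dirac mass when s = 0: in the library [normal_prob m 0] is the
   uniform law on [0, 1]. *)
Definition gaussian_law (m s : R) (A : set R) : \bar R :=
  if s == 0 then \d_m A else normal_prob m s A.

Context (d : measure_display) (T : measurableType d) (P : probability T R).
Context (n : nat).
Implicit Type X : 'rV[R]_n -> {RV P >-> R}.

(* All finite linear combinations are univariate (possibly degenerate)
   Gaussian. *)
Definition gaussian_field X : Prop :=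
  forall (k : nat) (a : 'I_k -> R) (t : 'I_k -> 'rV[R]_n),
    exists m s : R, 0 <= s /\
      forall A : set R, measurable A ->
        P ((fun w => \sum_(i < k) a i * X (t i) w) @^-1` A) =
        gaussian_law m s A.

Definition centered X : Prop := forall t, ('E_P[X t] = 0)%E.

(* Strict stationarity: the finite-dimensional distributions are invariant
   under translation. *)
Definition stationary X : Prop :=
  forall (k : nat) (t : 'I_k -> 'rV[R]_n) (h : 'rV[R]_n) (A : set (k.-tuple R)),
    measurable A ->
    P ((fun w => [tuple X (t i + h) w | i < k]) @^-1` A) =
    P ((fun w => [tuple X (t i) w | i < k]) @^-1` A).

Definition has_covariance X (C : 'rV[R]_n -> R) : Prop :=
  forall t tau, covariance P (X (t + tau)) (X t) = (C tau)%:E.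

Definition long_range_dependent X : Prop :=
  (\int[lebesgue_tuple n]_(tau in @positive_orthant n)
     `| covariance P (X (row_of_tuple tau)) (X 0%R) | = +oo)%E.

Definition cauchy_covariance (alpha beta : R) (tau : 'rV[R]_n) : R :=
  (1 + enorm tau `^ alpha) `^ (- beta).

End gaussian_field.

(* Main.v *)
(** Cut the positive orthant into the dyadic shells
    ]0, 2^k]^n \ ]0, 2^(k-1)]^n. On the k-th shell the norm is comparable to
    2^k, so the covariance is comparable to 2^(- k alpha beta), while the volume
    is comparable to 2^(k n). The integral is therefore comparable to the
    geometric series of ratio 2^(n - alpha beta), which diverges exactly when
    alpha beta <= n. *)

Require Import Defs.
From mathcomp Require Import all_boot all_order all_algebra.
From mathcomp Require Import all_classical all_reals all_analysis.
From mathcomp Require Import measurable_realfun lra.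

Set Implicit Arguments.
Unset Strict Implicit.
Unset Printing Implicit Defensive.

Import Order.TTheory GRing.Theory Num.Theory.
Import numFieldNormedType.Exports.

Local Open Scope classical_set_scope.
Local Open Scope ring_scope.

(** * Comparison of the Euclidean norm with the coordinates *)

Section euclidean_norm.
Context {R : realType} (n : nat).
Implicit Types (x : 'rV[R]_n) (M : R).

Lemma enorm_ge0 x : 0 <= enorm x.
Proof. exact: sqrtr_ge0. Qed.

Lemma le_coord_enorm x i : `|x 0 i| <= enorm x.
Proof.
rewrite -sqrtr_sqr ler_wsqrtr// (bigD1 i)//= lerDl.
by apply: sumr_ge0 => j _; exact: sqr_ge0.
Qed.

Lemma enorm_le_coord x M : 0 <= M -> (forall i, `|x 0 i| <= M) ->
  enorm x <= Num.sqrt n%:R * M.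
Proof.
move=> M0 xM; rewrite -[in leRHS](ger0_norm M0) -sqrtr_sqr -sqrtrM ?ler0n//.
apply: ler_wsqrtr; rewrite mulr_natl -[n in leRHS]card_ord -sumr_const.
by apply: ler_sum => i _; rewrite -real_normK ?num_real// lerXn2r ?nnegrE.
Qed.

Lemma measurable_enorm_row :
  measurable_fun setT
    (fun x : n.-tuple (measurableTypeR R) => enorm (row_of_tuple x)).
Proof.
(* Writing the square root as the power 1/2 reduces the claim to measurability of [powR] and of a
   polynomial in the coordinates. *)
have -> : (fun x : n.-tuple (measurableTypeR R) => enorm (row_of_tuple x)) =
    (@powR R ^~ 2^-1) \o
    (fun x : n.-tuple (measurableTypeR R) => \sum_(i < n) tnth x i ^+ 2).
  apply/funext => x /=; rewrite powR12_sqrt; last first.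
    by apply: sumr_ge0 => i _; exact: sqr_ge0.
  by congr Num.sqrt; apply: eq_bigr => i _; rewrite mxE.
apply: measurableT_comp; first exact: measurable_powR.
apply: measurable_sum => i; apply: measurable_funX; exact: measurable_tnth.
Qed.

End euclidean_norm.

(** * Power-law bounds for the covariance function *)

Section cauchy_covariance.
Context {R : realType} (n : nat) (alpha beta : R).
Hypotheses (alpha0 : 0 < alpha) (beta0 : 0 < beta).
Implicit Types (x : 'rV[R]_n) (M : R).

Let C := @cauchy_covariance R n alpha beta.

Lemma cauchy_covariance_ge0 x : 0 <= C x.
Proof. exact: powR_ge0. Qed.

Lemma cauchy_covariance_le1 x : C x <= 1.
Proof.
rewrite -[leRHS](powRr0 (1 + enorm x `^ alpha)); apply: ler_powR.
  by rewrite lerDl powR_ge0.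
by rewrite oppr_le0 ltW.
Qed.

Lemma powRN_anti (a b : R) : 0 < a -> a <= b -> b `^ (- beta) <= a `^ (- beta).
Proof.
move=> a0 ab; have b0 := lt_le_trans a0 ab.
by rewrite !powRN lef_pV2 ?posrE ?powR_gt0// ge0_ler_powR ?nnegrE // ltW.
Qed.

(** Dropping the summand 1 shrinks the base, and the negative exponent reverses the inequality. *)
Lemma cauchy_covariance_le x M : 0 < M -> M <= enorm x ->
  C x <= M `^ (- (alpha * beta)).
Proof.
move=> M0 Mx; rewrite -mulrN powRrM; apply: powRN_anti; first exact: powR_gt0.
rewrite (@le_trans _ _ (enorm x `^ alpha)) ?lerDr//.
by rewrite ge0_ler_powR ?nnegrE ?enorm_ge0// ltW.
Qed.

Lemma cauchy_covariance_ge x (r M : R) : 0 <= r -> 1 <= M ->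
  enorm x <= r * M ->
  (1 + r `^ alpha) `^ (- beta) * M `^ (- (alpha * beta)) <= C x.
Proof.
move=> r0 M1 xM; have M0 : 0 <= M by exact: le_trans M1.
have ra0 : 0 <= 1 + r `^ alpha by rewrite addr_ge0 ?powR_ge0.
rewrite -mulrN powRrM -(powRM _ ra0 (powR_ge0 M alpha)).
apply: powRN_anti; first by rewrite ltr_pwDl// powR_ge0.
rewrite mulrDl mul1r lerD//.
  by rewrite -[leLHS](powRr0 M) ler_powR// ltW.
by rewrite -powRM// ge0_ler_powR ?nnegrE ?enorm_ge0 ?mulr_ge0// ltW.
Qed.

Lemma measurable_cauchy_covariance_row :
  measurable_fun setT
    (fun x : n.-tuple (measurableTypeR R) => C (row_of_tuple x)).
Proof.
apply: (measurableT_comp (measurable_powR (- beta))).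
apply: measurable_funD => //.
apply: (measurableT_comp (measurable_powR alpha)).
exact: measurable_enorm_row.
Qed.

End cauchy_covariance.

(** * Dyadic boxes and shells of the positive orthant *)

Section dyadic_box.
Context {R : realType} (n : nat).
Local Notation mu := (@lebesgue_tuple R n).

(** The endpoint 0 is excluded so that the boxes exhaust exactly the open orthant. *)
Definition dyadic_box (k : nat) : set (n.-tuple (measurableTypeR R)) :=
  [set x | forall i, `]0%R, (2 ^+ k)%R]%classic (tnth x i)].

Lemma measurable_dyadic_box k : measurable (dyadic_box k).
Proof.
rewrite (_ : dyadic_box k = \big[setI/setT]_(i < n)
    ((@tnth _ (measurableTypeR R) ^~ i) @^-1` `]0%R, (2 ^+ k)%R]%classic)).
  apply: bigsetI_measurable => i _.
  by rewrite -[X in measurable X]setTI; apply: measurable_tnth.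
apply/seteqP; split => x /=.
  by move=> h; rewrite -bigcap_seq => i _; exact: h.
by rewrite -bigcap_seq => h i; apply: h; rewrite /= mem_index_enum.
Qed.

Lemma subset_dyadic_box : {homo dyadic_box : k l / (k <= l)%N >-> (k <= l)%O}.
Proof.
move=> k l kl; apply/subsetPset => x xk i.
have := xk i; rewrite /= !in_itv/= => /andP[-> /le_trans]; apply.
by rewrite ler_eXn2l// ltr1n.
Qed.

Lemma lebesgue_dyadic_box k : mu (dyadic_box k) = (2 ^+ (k * n))%:E.
Proof.
rewrite /dyadic_box (lebesgue_tuple_box (fun=> measurable_itv _)).
rewrite (eq_bigr (fun=> (2 ^+ k)%:E)); last first.
  move=> i _; rewrite lebesgue_measure_itv/= lte_fin exprn_gt0//.
  by rewrite oppr0 adde0.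
by rewrite prodEFin prodr_const card_ord exprM.
Qed.

Lemma positive_orthant_bigcup : @positive_orthant R n = \bigcup_k dyadic_box k.
Proof.
apply/seteqP; split => x /=; last first.
  by move=> [k _ xk] i; have := xk i; rewrite /= in_itv/= => /andP[].
(* One exponent must serve all coordinates: each is below its truncation plus one, hence below the
   sum [k] of these, and [k < 2 ^ k]. *)
move=> x0; pose k := (\sum_(i < n) (Num.truncn (tnth x i)).+1)%N.
exists k => // i; rewrite /= in_itv/= x0/=.
rewrite (le_trans (ltW (truncnS_gt _)))// -natrX ler_nat.
apply: leq_trans (ltnW (ltn_expl k _)) => //.
by rewrite /k (bigD1 i)//= leq_addr.
Qed.

(** The shell of index 0 is the whole unit box, which reaches down to the origin; later bounds treat
    it apart. *)
Definition dyadic_shell := seqD dyadic_box.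

Lemma measurable_dyadic_shell k : measurable (dyadic_shell k).
Proof.
case: k => [|k]; first exact: measurable_dyadic_box.
by apply: measurableD; exact: measurable_dyadic_box.
Qed.

Lemma dyadic_shell_sub k : dyadic_shell k `<=` dyadic_box k.
Proof. by case: k => // k x []. Qed.

Lemma lebesgue_dyadic_shell_le k : (mu (dyadic_shell k) <= (2 ^+ (k * n))%:E)%E.
Proof.
rewrite -lebesgue_dyadic_box le_measure ?inE//.
- exact: measurable_dyadic_shell.
- exact: measurable_dyadic_box.
- exact: dyadic_shell_sub.
Qed.

(** Passing from one box to the next multiplies the volume by [2 ^+ n], at least 2 as [0 < n], so
    removing the smaller box leaves at least half of the larger. *)
Lemma lebesgue_dyadic_shell_ge k : (0 < n)%N ->
  ((2 ^+ (k * n) / 2)%:E <= mu (dyadic_shell k))%E.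
Proof.
move=> n0; case: k => [|k].
  by rewrite lebesgue_dyadic_box mul0n expr0 lee_fin; lra.
have /setIidPr sub : dyadic_box k `<=` dyadic_box k.+1.
  exact/subsetPset/subset_dyadic_box.
have -> : mu (dyadic_shell k.+1) = (mu (dyadic_box k.+1) - mu (dyadic_box k))%E.
  rewrite -[in RHS]sub; apply: measureD => //.
  - exact: measurable_dyadic_box.
  - exact: measurable_dyadic_box.
  - by rewrite [X in (X < _)%E]lebesgue_dyadic_box ltry.
rewrite !lebesgue_dyadic_box -EFinB lee_fin mulSn exprD.
have : 2 <= 2 ^+ n :> R by rewrite -[leLHS]expr1 ler_eXn2l ?ltr1n.
have : 0 < 2 ^+ (k * n) :> R by exact: exprn_gt0.
nra.
Qed.

Lemma dyadic_shell_enorm_le k x : dyadic_shell k x ->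
  enorm (row_of_tuple x) <= Num.sqrt n%:R * 2 ^+ k.
Proof.
move=> /dyadic_shell_sub xk; apply: enorm_le_coord; first exact: exprn_ge0.
move=> i; rewrite mxE; have := xk i; rewrite /= in_itv/= => /andP[xi0 xik].
by rewrite gtr0_norm.
Qed.

(** A point outside the smaller box has a coordinate above [2 ^+ k], because all its coordinates are
    positive. *)
Lemma dyadic_shell_enorm_ge k x : dyadic_shell k.+1 x ->
  2 ^+ k <= enorm (row_of_tuple x).
Proof.
move=> [xk /existsNP[i xki]]; apply: le_trans (le_coord_enorm _ i).
rewrite mxE (le_trans _ (ler_norm _))// leNgt; apply/negP => xik; apply: xki.
have := xk i; rewrite /= !in_itv/= => /andP[-> _].
exact: ltW.
Qed.

(** The shells are disjoint and have the same union as the increasing boxes, so countable additivity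
    applies. *)
Lemma ge0_integral_orthant (f : n.-tuple (measurableTypeR R) -> \bar R) :
  measurable_fun setT f -> (forall x, 0 <= f x)%E ->
  (\int[mu]_(x in @positive_orthant R n) f x =
   \sum_(0 <= k <oo) \int[mu]_(x in dyadic_shell k) f x)%E.
Proof.
move=> mf f0; rewrite positive_orthant_bigcup -eq_bigcup_seqD.
apply: ge0_integral_bigcup => //.
- exact: measurable_dyadic_shell.
- exact: measurable_funTS.
- exact/trivIset_seqD/subset_dyadic_box.
Qed.

End dyadic_box.

(** * The two comparison series, geometric and constant *)

Lemma nneseries_geometric_lty {R : realType} (a z : R) : 0 <= z < 1 ->
  (\sum_(0 <= k <oo) (a * z ^+ k)%:E < +oo)%E.
Proof.
move=> /andP[z0 z1].
rewrite (_ : (fun m => \sum_(0 <= k < m) (a * z ^+ k)%:E)%E =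
    EFin \o series (geometric a z)).
  by rewrite EFin_lim ?ltry//; apply: is_cvg_geometric_series; rewrite ger0_norm.
by apply/funext => m; rewrite /= /series/= -sumEFin.
Qed.

(** A finite sum would force the constant term to tend to 0. *)
Lemma nneseries_cst_pinfty {R : realType} (c : R) : 0 < c ->
  (\sum_(0 <= k <oo) c%:E = +oo)%E.
Proof.
move=> c0; apply/eqP; rewrite eq_le leey/= leNgt; apply/negP.
move=> /(nnseries_is_cvg (fun=> ltW c0))/cvg_series_cvg_0 c_cvg.
suff /eqP : 0 = c by rewrite lt_eqF.
exact: (cvg_unique _ c_cvg (cvg_cst c)).
Qed.

(** * Convergence and divergence of the covariance integral *)

Section integral_cauchy_covariance.
Context {R : realType} (n : nat) (alpha beta : R).
Hypotheses (n0 : (0 < n)%N) (alpha0 : 0 < alpha) (beta0 : 0 < beta).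
Local Notation mu := (@lebesgue_tuple R n).
Local Notation C x := (@cauchy_covariance R n alpha beta (row_of_tuple x)).

Let mC D : measurable_fun D
  (fun x : n.-tuple (measurableTypeR R) => (C x)%:E).
Proof.
apply: measurable_funTS; apply/measurable_EFinP.
exact: measurable_cauchy_covariance_row.
Qed.

Let C_ge0 x : (0 <= (C x)%:E)%E.
Proof. by rewrite lee_fin cauchy_covariance_ge0. Qed.

Lemma integral_cauchy_covariance_shell_le k :
  (\int[mu]_(x in dyadic_shell k) (C x)%:E <=
   (2 `^ (alpha * beta) * (2 `^ (n%:R - alpha * beta)) ^+ k)%:E)%E.
Proof.
have ab0 : 0 < alpha * beta by exact: mulr_gt0.
(* This is [2 ^ (k - 1)] to the power [- (alpha * beta)]: the norm on shell [k] is only bounded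
   below by [2 ^ (k - 1)], whence the extra factor. *)
pose M : R := 2 `^ (alpha * beta) * 2 `^ (- (alpha * beta) * k%:R).
have CM x : dyadic_shell k x -> C x <= M.
  rewrite /M {M}; case: k => [_|k xk].
    rewrite mulr0 powRr0 mulr1 (le_trans (cauchy_covariance_le1 _ beta0 _))//.
    by rewrite -[leLHS](powRr0 2) ler_powR ?ler1n// ltW.
  rewrite (le_trans (cauchy_covariance_le _ _ _ (dyadic_shell_enorm_ge xk)))//.
  rewrite -powRD ?pnatr_eq0 ?implybT// -powR_mulrn// -powRrM.
  by rewrite ler_powR ?ler1n// -[k.+1]addn1 natrD; lra.
apply: (@le_trans _ _ (\int[mu]_(x in dyadic_shell k) cst M%:E x)%E).
  apply: ge0_le_integral => //; first exact: measurable_dyadic_shell.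
rewrite integral_cst; last exact: measurable_dyadic_shell.
have M0 : 0 <= M by rewrite mulr_ge0 ?powR_ge0.
apply: le_trans (lee_wpmul2l _ (lebesgue_dyadic_shell_le n k)) _ => //.
rewrite -EFinM lee_fin /M -mulrA ler_wpM2l ?powR_ge0//.
rewrite -!powR_mulrn ?powR_ge0// -powRrM -powRD ?pnatr_eq0 ?implybT//.
by rewrite natrM ler_powR ?ler1n//; lra.
Qed.

(** The bound does not depend on [k]: when [alpha * beta <= n] the covariance decays no faster than
    the shell volume grows. *)
Lemma integral_cauchy_covariance_shell_ge k : alpha * beta <= n%:R ->
  (((1 + Num.sqrt n%:R `^ alpha) `^ (- beta) / 2)%:E <=
   \int[mu]_(x in dyadic_shell k) (C x)%:E)%E.
Proof.
move=> abn; pose c : R := (1 + Num.sqrt n%:R `^ alpha) `^ (- beta).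
(* The decay exponent is weakened from [alpha * beta] to [n], so that the power of 2 cancels exactly
   against the volume. *)
pose m : R := c / 2 ^+ (k * n).
have c0 : 0 <= c by exact: powR_ge0.
have mCx x : dyadic_shell k x -> m <= C x.
  move=> xk; have M1 : 1 <= 2 ^+ k :> R by rewrite exprn_ege1// ler1n.
  apply: le_trans (cauchy_covariance_ge alpha0 beta0 _ M1
    (dyadic_shell_enorm_le xk)) => //.
  rewrite ler_wpM2l// exprM -[X in X^-1]powR_mulrn ?exprn_ge0// -powRN.
  by rewrite ler_powR// lerN2.
apply: (@le_trans _ _ (\int[mu]_(x in dyadic_shell k) cst m%:E x)%E); last first.
  apply: ge0_le_integral => //; first exact: measurable_dyadic_shell.
  by move=> x _; rewrite lee_fin divr_ge0// exprn_ge0.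
rewrite integral_cst; last exact: measurable_dyadic_shell.
apply: le_trans (lee_wpmul2l _ (lebesgue_dyadic_shell_ge k n0)); last first.
  by rewrite lee_fin divr_ge0// exprn_ge0.
by rewrite -EFinM lee_fin /m mulrA divfK// expf_neq0// pnatr_eq0.
Qed.

Lemma integral_cauchy_covariance_pinfty :
  (\int[mu]_(x in @positive_orthant R n) (C x)%:E = +oo)%E <->
  alpha * beta <= n%:R.
Proof.
rewrite ge0_integral_orthant//; split => [Coo|abn]; last first.
  apply/eqP; rewrite eq_le leey/=.
  rewrite -(@nneseries_cst_pinfty _ ((1 + Num.sqrt n%:R `^ alpha) `^ (- beta) / 2)).
    apply: lee_nneseries => k *; last exact: integral_cauchy_covariance_shell_ge.
    by rewrite lee_fin divr_ge0// powR_ge0.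
  by rewrite divr_gt0// powR_gt0// ltr_pwDl// powR_ge0.
rewrite leNgt; apply/negP => nab.
have : (+oo < +oo :> \bar R)%E; last by rewrite ltxx.
rewrite -[in ltLHS]Coo.
apply: (le_lt_trans (lee_nneseries _ _))
    (nneseries_geometric_lty (2 `^ (alpha * beta)) _).
- by move=> k _ _; apply: integral_ge0.
- by move=> k _; exact: integral_cauchy_covariance_shell_le.
- have sn : n%:R - alpha * beta < 0 by rewrite subr_lt0.
  (* The ratio is below 1: it is at most 1, and it differs from 1 because its exponent is
     nonzero. *)
  rewrite powR_ge0/= lt_neqAle powR_eq1 pnatr_eq1 ltrn0 (lt_eqF sn)/=.
  by rewrite -[leRHS](powRr0 2) ler_powR ?ler1n// ltW.
Qed.

End integral_cauchy_covariance.

Theorem proposition2p8 (R : realType) (d : measure_display)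
    (T : measurableType d) (P : probability T R) (n : nat) (alpha beta : R)
    (X : 'rV[R]_n -> {RV P >-> R})
    (hn : (1 <= n)%N) (halpha : 0 < alpha <= 2) (hbeta : 0 < beta)
    (Xgauss : gaussian_field X) (Xcentered : centered X)
    (Xstat : stationary X)
    (Xcov : has_covariance X (cauchy_covariance alpha beta)) :
  long_range_dependent X <-> 0 < alpha * beta <= n%:R.
Proof.
have /andP[alpha0 _] := halpha.
rewrite mulr_gt0//= -integral_cauchy_covariance_pinfty//.
rewrite /long_range_dependent.
rewrite (eq_integral (fun x : n.-tuple (measurableTypeR R) =>
  (cauchy_covariance alpha beta (row_of_tuple x))%:E))// => x _.
(* The covariance hypothesis is taken at base point 0; nonnegativity then removes the absolute
   value. *)
have := Xcov 0 (row_of_tuple x); rewrite add0r => ->.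
by rewrite gee0_abs// lee_fin cauchy_covariance_ge0.
Qed.
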